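(* Let $k\ge3$ be an integer, let $\lambda\in\mathbb{C}\setminus\{-n/2:n\in\mathbb{N}\}$, and let $\{p_n\}_{n\ge0}$ be the monic sieved OPS of the second kind, $p_n(x)=\nu_nB_n^\lambda(x;k)$ with $\nu_n:=\lfloor n/k\rfloor!/\{2^n(\lambda+1)_{\lfloor n/k\rfloor}\}$. Then $\{p_n\}_{n\ge0}$ satisfies the structure relation $$\Phi(x)\,p_{nk+j}'(x)=M_{nk+j}(x)\,p_{nk+j+1}(x)+N_{nk+j}(x)\,p_{nk+j}(x)$$ for every $n=0,1,2,\dots$ and $0\le j\le k-1$, where $$\Phi(x)=(1-x^2)\widehat U_{k-1}(x),$$ $$M_{nk+j}(x)=-2(nk+j+1+\lambda k)\widehat U_{k-1}(x)-\tfrac{\lambda k}{2}\big(\widehat U_{j-1}(x)\widehat U_{k-j-2}(x)-\widehat U_j(x)\widehat U_{k-j-3}(x)\big),$$ $$N_{nk+j}(x)=(nk+j+2+2\lambda k)\,x\,\widehat U_{k-1}(x)-\lambda k\,\epsilon_j\,\widehat U_{k-2}(x)+\tfrac{\lambda k}{8}\big(\widehat U_{j-1}(x)\widehat U_{k-j-3}(x)-\widehat U_j(x)\widehat U_{k-j-4}(x)\big),$$ with $\epsilon_{k-1}:=1$, $\epsilon_{k-2}:=0$, and $\epsilon_j:=\frac12$ for $0\le j\le k-3$.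
   Context: $\mathbb{N}=\{1,2,\dots\}$. $(\alpha)_0:=1$ and $(\alpha)_n:=\alpha(\alpha+1)\cdots(\alpha+n-1)$ for $n\ge1$. OPS = orthogonal polynomial sequence (with respect to a regular linear functional on complex polynomials). Chebyshev polynomials of the second kind: $U_n(\cos\theta)=\sin((n+1)\theta)/\sin\theta$; monic version $\widehat U_n:=2^{-n}U_n$ for $n\ge0$, and by convention $\widehat U_n:=0$ for every negative index $n$. Sieved ultraspherical polynomials of the second kind: the polynomials $C_n(x;\beta|q)$ are defined by $C_0(x;\beta|q)=1$, $C_1(x;\beta|q)=2x(1-\beta)/(1-q)$ and, for $n\ge 1$, $2x(1-\beta q^n)C_n=(1-q^{n+1})C_{n+1}+(1-\beta^2q^{n-1})C_{n-1}$, with $|q|<1$. With $\omega_k:=e^{2\pi i/k}$, $B_n^\lambda(x;k):=\lim_{s\to1}C_n(x;s^{\lambda k+1}\omega_k\,|\,s\omega_k)$ (limit over $s\in(0,1)$). Equivalently, the monic polynomials $p_n$ satisfy $p_0=1$, $p_1=x$, $p_{N+1}=xp_N-\gamma_Np_{N-1}$ ($N\ge1$), where $\gamma_{mk}=\frac{m}{4(m+\lambda)}$ for $m\ge1$, $\gamma_{mk+k-1}=\frac{m+1+2\lambda}{4(m+1+\lambda)}$ for $m\ge0$, and $\gamma_N=\frac14$ for all other $N\ge1$. *)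

(* Defs.v *)
From HB Require Import structures.
From mathcomp Require Import all_boot all_order all_algebra.
From mathcomp Require Import ring complex.
From mathcomp Require Import all_classical all_reals all_analysis.
Set Implicit Arguments.
Unset Strict Implicit.
Unset Printing Implicit Defensive.
Import Order.TTheory GRing.Theory Num.Theory.
Import numFieldNormedType.Exports.
Local Open Scope classical_set_scope.
Local Open Scope ring_scope.

(* MathComp-Analysis equips every abstract [numFieldType] with its usual
   topology but does not find that instance on the bare type [R[i]]; naming the
   structure makes the (modulus) topology available on the complex numbers.    *)
Definition Cplx (R : realType) : numClosedFieldType := R[i]%C.

Definition ofReal (R : realType) (x : R) : Cplx R := (x%:C)%C.
Definition ofReIm (R : realType) (x y : R) : Cplx R := (x +i* y)%C.

(* s^a = exp (a ln s) for real s > 0 and complex a (principal branch). *)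
Definition cpow (R : realType) (s : R) (a : Cplx R) : Cplx R :=
  let r := expR (complex.Re a * ln s) in
  let t := complex.Im a * ln s in
  ofReIm (r * cos t) (r * sin t).

(* e^{2 pi i / k} *)
Definition omega (R : realType) (k : nat) : Cplx R :=
  ofReIm (cos (2 * pi / k%:R)) (sin (2 * pi / k%:R)).

Definition pochhammer (K : fieldType) (a : K) (n : nat) : K :=
  \prod_(i < n) (a + i%:R).

Fixpoint chebyshevU (K : fieldType) (n : nat) : {poly K} :=
  match n with
  | 0 => 1
  | n'.+1 => match n' with
             | 0 => 2%:R *: 'X
             | m.+1 => 2%:R *: 'X * chebyshevU K n' - chebyshevU K m
             end
  end.

Definition Uhat (K : fieldType) (n : int) : {poly K} :=
  match n with
  | Posz m => (2%:R ^- m) *: chebyshevU K m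
  | Negz _ => 0
  end.

Lemma chebyshevU_cos (R : realType) (n : nat) (t : R) :
  (chebyshevU R n).[cos t] * sin t = sin (n.+1%:R * t).
Proof.
suff: (chebyshevU R n).[cos t] * sin t = sin (n.+1%:R * t) /\
      (chebyshevU R n.+1).[cos t] * sin t = sin (n.+2%:R * t) by case.
elim: n => [|n [IH1 IH2]].
  rewrite /= !hornerE; split; first by [].
  have -> : 2%:R * t = t + t by ring.
  by rewrite sinD; ring.
split=> //.
rewrite [chebyshevU R n.+2]/= -/(chebyshevU R n.+1).
rewrite hornerD hornerN hornerM mulrBl -mulrA IH2 IH1 !hornerE.
have -> : n.+3%:R * t = n.+2%:R * t + t by rewrite -[n.+3]addn1 natrD; ring.
have -> : n.+1%:R * t = n.+2%:R * t - t by rewrite -[n.+2]addn1 natrD; ring.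
by rewrite sinB sinD; ring.
Qed.

(* The polynomial x |-> C_n(x; b | q). *)
Fixpoint qultra (K : fieldType) (b q : K) (n : nat) : {poly K} :=
  match n with
  | 0 => 1
  | n'.+1 => match n' with
    | 0 => (2%:R * (1 - b) / (1 - q)) *: 'X
    | m.+1 =>
        (1 - q ^+ n'.+1)^-1 *:
          (2%:R * (1 - b * q ^+ n') *: 'X * qultra b q n'
           - (1 - b ^+ 2 * q ^+ m) *: qultra b q m)
    end
  end.

(* B_n^lambda(x; k) *)
Definition sievedB (R : realType) (k : nat) (lam : Cplx R) (n : nat)
    (x : Cplx R) : Cplx R :=
  lim ((qultra (cpow s (lam * k%:R + 1) * omega R k)
               (ofReal s * omega R k) n).[x] @[s --> (1 : R)^'-]).

Definition nu (K : fieldType) (k : nat) (lam : K) (n : nat) : K :=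
  ((n %/ k)`!)%:R / (2%:R ^+ n * pochhammer (lam + 1) (n %/ k)).

Definition eps (K : fieldType) (k j : nat) : K :=
  if j == (k - 1)%N then 1 else if j == (k - 2)%N then 0 else 2%:R^-1.

Definition Phi (K : fieldType) (k : nat) : {poly K} := (1 - 'X^2) * Uhat K (k%:Z - 1).

Definition Mpoly (K : fieldType) (k : nat) (lam : K) (n j : nat) : {poly K} :=
  let U := Uhat K in
  - (2%:R * ((n * k + j + 1)%:R + lam * k%:R)) *: U (k%:Z - 1)
  - (lam * k%:R / 2%:R) *:
      (U (j%:Z - 1) * U (k%:Z - j%:Z - 2) - U j%:Z * U (k%:Z - j%:Z - 3)).

Definition Npoly (K : fieldType) (k : nat) (lam : K) (n j : nat) : {poly K} :=
  let U := Uhat K in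
  ((n * k + j + 2)%:R + 2%:R * lam * k%:R) *: ('X * U (k%:Z - 1))
  - (lam * k%:R * eps K k j) *: U (k%:Z - 2)
  + (lam * k%:R / 8%:R) *:
      (U (j%:Z - 1) * U (k%:Z - j%:Z - 3) - U j%:Z * U (k%:Z - j%:Z - 4)).

(* Main.v *)
Require Import Defs.
From mathcomp Require Import all_boot all_order all_algebra.
From mathcomp Require Import ring lra zify complex.
From mathcomp Require Import all_classical all_reals all_analysis.
Set Implicit Arguments.
Unset Strict Implicit.
Unset Printing Implicit Defensive.
Import Order.TTheory GRing.Theory Num.Theory.
Import numFieldNormedType.Exports.
Local Open Scope ring_scope.

(** Why the theorem is true.

    For a monic sequence with [p (i+1) = 'X p i - g i p (i-1)], a structure
    relation [F p_i' = M_i p_(i+1) + N_i p_i] propagates from [i] to [i+1] as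
    soon as the polynomial coefficients satisfy the Laguerre-Freud equations
      [N_(i+1) - N_(i-1) = 'X (M_i - M_(i+1))],
      [F + 'X (N_i - N_(i-1)) = g_i M_(i-1) - g_(i+1) M_(i+1)]:
    differentiate the recurrence and eliminate (lemma
    [structure_of_laguerre_freud]).  No orthogonality is involved, so what
    remains is to know the recurrence coefficients of the sieved polynomials
    and to verify these two equations.

    The recurrence coefficients come from the limit [s -> 1] in the
    recurrence of the polynomials [C_n(x; b | q)].  With [z] a power of the
    root of unity [omega], the quotients occurring there are of the form
    [(1 - s^b z) / (1 - s^m z)]; they tend to [1] if [z <> 1], and to [b / m],
    the quotient of the derivatives of [s^b] and [s^m] at [1], if [z = 1]
    (lemma [cvg_cpow_quot]).  The second case arises exactly when the index is
    a multiple of [k], which is why the recurrence is that of the Chebyshev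
    polynomials except near the multiples of [k].

    The Laguerre-Freud equations are then verified according to the residue of
    the index modulo [k] (lemma [sieved_laguerre_freud]).  Inside a block of
    length [k] the recurrence coefficient is 1/4, and after using the Chebyshev
    recurrence both equations become polynomial identities in four Chebyshev
    polynomials.  At the block boundaries, [M] at a multiple of [k] is a
    multiple of [U_(k-1)] whose scalar factor cancels the denominator
    [n + lam] of the recurrence coefficient; between the two exceptional
    coefficients of a boundary, whose denominators are equal, only their sum
    1/2 and their difference [lam / (2 (n + lam))] enter. *)

(** * Polynomial identities checked pointwise *)

(** Turns an identity of polynomials into one in the field of scalars, where
    the constants 1/2, 1/4, 1/8 can be cleared. *)
Lemma poly_horner_inj (K : numFieldType) (p q : {poly K}) :
  (forall x, p.[x] = q.[x]) -> p = q.
Proof.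
move=> pq; apply/eqP; rewrite -subr_eq0; apply/eqP.
apply: (@roots_geq_poly_eq0 _ _ [seq i%:R | i <- iota 0 (size (p - q))]).
- by apply/allP => x _; rewrite /root !hornerE pq subrr.
- rewrite map_inj_uniq ?iota_uniq // => i j /eqP.
  by rewrite eqr_nat => /eqP.
- by rewrite size_map size_iota.
Qed.

Definition horner_ringE :=
  (hornerD, hornerN, hornerM, hornerZ, hornerX, hornerXn, hornerC).

(** * Structure relations and Laguerre-Freud equations *)

(** [M i] and [N i] are the coefficients belonging to [p (i - 1)].  With this
    shift the index [-1] of the Laguerre-Freud equations becomes [0], and
    [g 0 = 0] removes the missing [p (-1)].  The induction carries, next to the
    relation for [p i], the relation for [g i * p (i - 1)], written as
    ['X * p i - p i.+1] so that it makes sense for [i = 0] too. *)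
Lemma structure_of_laguerre_freud (K : comNzRingType) (p : nat -> {poly K})
    (g : nat -> K) (F : {poly K}) (M N : nat -> {poly K}) :
  p 0%N = 1 -> p 1%N = 'X ->
  (forall i, p i.+2 = 'X * p i.+1 - g i.+1 *: p i) ->
  g 0%N = 0 ->
  'X * M 1%N + N 1%N = 0 ->
  (forall i, N i.+2 - N i = 'X * (M i.+1 - M i.+2)) ->
  (forall i, F + 'X * (N i.+1 - N i) = g i *: M i - g i.+1 *: M i.+2) ->
  forall i, F * (p i)^`() = M i.+1 * p i.+1 + N i.+1 * p i.
Proof.
move=> p0 p1 prec g0 init LF1 LF2.
have step i : F * (p i)^`() = M i.+1 * p i.+1 + N i.+1 * p i ->
   F * ('X * p i - p i.+1)^`() = (g i *: M i) * p i + N i * ('X * p i - p i.+1) ->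
   F * (p i.+1)^`() = M i.+2 * p i.+2 + N i.+2 * p i.+1.
  rewrite prec derivB derivM derivX -!mul_polyC => Hi Hr.
  have eN : N i.+2 = N i + 'X * (M i.+1 - M i.+2) by rewrite -LF1; ring.
  have := LF2 i; rewrite -!mul_polyC => eF.
  have -> : F * (p i.+1)^`() = F * p i + 'X * (F * (p i)^`()) -
     F * (1 * p i + 'X * (p i)^`() - (p i.+1)^`()) by ring.
  rewrite Hr Hi eN.
  have -> : (g i)%:P * M i = F + 'X * (N i.+1 - N i) + (g i.+1)%:P * M i.+2.
    by rewrite eF; ring.
  by ring.
suff H i : F * (p i)^`() = M i.+1 * p i.+1 + N i.+1 * p i /\
    F * ('X * p i - p i.+1)^`() = (g i *: M i) * p i + N i * ('X * p i - p i.+1).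
  by move=> i; case: (H i).
elim: i => [|i [IH1 IH2]].
  rewrite p0 p1 g0 scale0r !mulr1 subrr derivC deriv0 !mulr0 addr0; split=> //.
  by rewrite mulrC init.
split; first exact: step.
rewrite prec opprB addrC subrK derivZ -scalerAr IH1.
by rewrite -!mul_polyC; ring.
Qed.

(** * Monic Chebyshev polynomials continued to index -2 *)

(** [chebW K i] is the monic Chebyshev polynomial of index [i - 2].  The values
    at [0] and [1] continue the recurrence backwards, so that the coefficient
    formulas of the structure relation are uniform except at the last polynomial
    of a block.  They differ from the convention of [Uhat] in the index -2 only,
    which is met at residue [k - 2] and is the reason why [eps] is [0] there. *)
Fixpoint chebW (K : fieldType) (i : nat) : {poly K} :=
  match i with
  | 0 => (- 4%:R)%:P
  | i'.+1 => match i' with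
             | 0 => 0
             | i''.+1 => 'X * chebW K i' - 4%:R^-1 *: chebW K i''
             end
  end.

Arguments chebW : simpl never.

Lemma chebW0 (K : fieldType) : chebW K 0 = (- 4%:R)%:P.
Proof. by []. Qed.

Lemma chebW1 (K : fieldType) : chebW K 1 = 0.
Proof. by []. Qed.

Lemma chebWS (K : fieldType) i :
  chebW K i.+2 = 'X * chebW K i.+1 - 4%:R^-1 *: chebW K i.
Proof. by []. Qed.

Lemma Uhat_chebW (K : numFieldType) (i : nat) : Uhat K (i%:Z - 1) = chebW K i.+1.
Proof.
suff H : forall n : nat, Uhat K n%:Z = chebW K n.+2.
  by case: i => [|i] //; rewrite -H intS addrC addKr.
move=> n; suff: Uhat K n%:Z = chebW K n.+2 /\
    Uhat K n.+1%:Z = chebW K n.+3 by case.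
elim: n => [|n [IH1 IH2]].
  split; apply: poly_horner_inj => x;
    by rewrite !chebWS chebW1 chebW0 /= !hornerE ?expr0 ?expr1 /=; field.
split=> //; rewrite chebWS -IH1 -IH2.
apply: poly_horner_inj => x.
rewrite /Uhat [chebyshevU _ n.+2]/= -/(chebyshevU K n.+1).
rewrite !hornerE !exprS /=; set t := 2 ^+ n.
have : t != 0 by rewrite expf_neq0 // pnatr_eq0.
by move=> ?; field.
Qed.

(** * Laguerre-Freud equations for the sieved polynomials *)

Definition sieved_gamma (K : fieldType) (k : nat) (lam : K) (i : nat) : K :=
  if (k %| i)%N then (i %/ k)%:R / (4%:R * ((i %/ k)%:R + lam))
  else if (k %| i.+1)%N then
    ((i.+1 %/ k)%:R + 2%:R * lam) / (4%:R * ((i.+1 %/ k)%:R + lam))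
  else 4%:R^-1.

(** The polynomials [Mpoly] and [Npoly], indexed as in
    [structure_of_laguerre_freud]: position [i] describes [p (i - 1)], so that
    the exceptional last polynomial of a block sits at residue [0]. *)
Definition structM (K : fieldType) (k : nat) (lam : K) (i : nat) : {poly K} :=
  let j := (i %% k)%N in let w := chebW K in
  - (2%:R * (i%:R + lam * k%:R)) *: w k.+1
  - (if j == 0%N then 0 else
     (lam * k%:R / 2%:R) *: (w j * w (k - j).+1 - w j.+1 * w (k - j)%N)).

Definition structN (K : fieldType) (k : nat) (lam : K) (i : nat) : {poly K} :=
  let j := (i %% k)%N in let w := chebW K in
  (i.+1%:R + 2%:R * lam * k%:R) *: ('X * w k.+1)
  - (if j == 0%N then (lam * k%:R) *: w k else
     (lam * k%:R / 2%:R) *: w k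
     - (lam * k%:R / 8%:R) *: (w j * w (k - j)%N - w j.+1 * w (k - j).-1)).

Section LaguerreFreud.
Variables (K : numFieldType) (k : nat) (lam : K).
Hypothesis k3 : (3 <= k)%N.
Hypothesis lamN : forall m, (0 < m)%N -> m%:R + lam != 0.

Let F : {poly K} := (1 - 'X^2) * chebW K k.+1.
Let M := structM k lam.
Let N := structN k lam.
Let g := sieved_gamma k lam.

Lemma sieved_gamma_dvd m : g (m * k)%N = m%:R / (4%:R * (m%:R + lam)).
Proof. by rewrite /g /sieved_gamma dvdn_mull // mulnK //; lia. Qed.

Lemma sieved_gamma_dvdS i m : i.+1 = (m * k)%N ->
  g i = (m%:R + 2%:R * lam) / (4%:R * (m%:R + lam)).
Proof.
move=> im; rewrite /g /sieved_gamma im dvdn_mull // mulnK; last by lia.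
case: ifP => // ki; have : (k %| i.+1)%N by rewrite im dvdn_mull.
by rewrite -addn1 dvdn_addr // dvdn1; lia.
Qed.

Lemma sieved_gamma_generic n j : (0 < j < k.-1)%N -> g (n * k + j)%N = 4%:R^-1.
Proof.
move=> jk; rewrite /g /sieved_gamma -addnS.
rewrite !dvdn_addr ?dvdn_mull // !gtnNdvd //; lia.
Qed.

Lemma structM_block n j : (0 < j < k)%N -> M (n * k + j)%N =
  - (2%:R * ((n * k + j)%:R + lam * k%:R)) *: chebW K k.+1
  - (lam * k%:R / 2%:R) *: (chebW K j * chebW K (k - j).+1
                            - chebW K j.+1 * chebW K (k - j)%N).
Proof.
by move=> /andP[j0 jk]; rewrite /M /structM modnMDl modn_small // gtn_eqF.
Qed.

Lemma structN_block n j : (0 < j < k)%N -> N (n * k + j)%N =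
  ((n * k + j).+1%:R + 2%:R * lam * k%:R) *: ('X * chebW K k.+1)
  - ((lam * k%:R / 2%:R) *: chebW K k
     - (lam * k%:R / 8%:R) *: (chebW K j * chebW K (k - j)%N
                               - chebW K j.+1 * chebW K (k - j).-1)).
Proof.
by move=> /andP[j0 jk]; rewrite /N /structN modnMDl modn_small // gtn_eqF.
Qed.

Lemma structM_start n : M (n * k)%N =
  - (2%:R * ((n * k)%:R + lam * k%:R)) *: chebW K k.+1.
Proof. by rewrite /M /structM modnMl eqxx subr0. Qed.

Lemma structN_start n : N (n * k)%N =
  ((n * k).+1%:R + 2%:R * lam * k%:R) *: ('X * chebW K k.+1)
  - (lam * k%:R) *: chebW K k.
Proof. by rewrite /N /structN modnMl eqxx. Qed.

Lemma laguerre_freud_init : 'X * M 1%N + N 1%N = 0.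
Proof.
rewrite (_ : 1 = 0 * k + 1)%N // structM_block ?structN_block; try lia.
have [r ->] : exists r, k = r.+3 by exists (k - 3)%N; lia.
rewrite !subSS !subn0 mul0n add0n /=.
rewrite !chebWS chebW1 chebW0; move: (chebW K r) (chebW K r.+1) => P Q.
by apply: poly_horner_inj => x; rewrite !horner_ringE; field.
Qed.

Let LF i := N i.+2 - N i = 'X * (M i.+1 - M i.+2) /\
  F + 'X * (N i.+1 - N i) = g i *: M i - g i.+1 *: M i.+2.

(** Inside a block [U_(k-1)] and [U_(k-2)] cancel out of both equations. *)
Lemma laguerre_freud_inner n j : (0 < j)%N -> (j.+2 < k)%N -> LF (n * k + j)%N.
Proof.
move=> j0 jk; rewrite /LF -!addnS !sieved_gamma_generic; try lia.
rewrite !structM_block ?structN_block; try lia.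
have [a [b [ea eb]]] : exists a b, j = a.+1 /\ k = (a + b).+4.
  by exists j.-1, (k - j - 3)%N; lia.
have [e1 e2 e3] : [/\ k - j = b.+3, k - j.+1 = b.+2 & k - j.+2 = b.+1]%N.
  by split; lia.
rewrite e1 e2 e3 ea /F !addnS !succnK.
move: (n * k + a)%N (k%:R) (chebW K k.+1) (chebW K k) => c kk V W.
rewrite !chebWS; move: (chebW K a) (chebW K a.+1) (chebW K b) (chebW K b.+1).
move=> P P' Q Q'; split; apply: poly_horner_inj => x;
  by rewrite !horner_ringE; field.
Qed.

(** The factor [n + lam] of [M] cancels the denominator of the recurrence
    coefficient; at [n = 0] that denominator may be zero, but both sides
    are then zero. *)
Lemma sieved_gamma_structM n : g (n * k)%N *: M (n * k)%N =
  - (n%:R * k%:R / 2%:R) *: chebW K k.+1.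
Proof.
rewrite sieved_gamma_dvd structM_start scalerA natrM; congr (_ *: _).
have [->|n0] := posnP n; first by rewrite !mul0r oppr0.
by have := lamN n0; move=> ?; field.
Qed.

Lemma sieved_gammaS_structM i n : i.+1 = (n.+1 * k)%N ->
  g i *: M (n.+1 * k)%N =
  - ((n.+1%:R + 2%:R * lam) * k%:R / 2%:R) *: chebW K k.+1.
Proof.
move=> ei; rewrite (sieved_gamma_dvdS ei) structM_start scalerA natrM.
congr (_ *: _); have := lamN (ltn0Sn n); move: (n.+1%:R) => t t0.
by field.
Qed.

Lemma laguerre_freud_first n : LF (n * k)%N.
Proof.
rewrite /LF sieved_gamma_structM structN_start -(addn2 (n * k)) -(addn1 (n * k)).
rewrite sieved_gamma_generic ?structM_block ?structN_block; try lia.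
have [r er] : exists r, k = r.+3 by exists (k - 3)%N; lia.
have [e1 e2 e3] : [/\ k - 1 = r.+2, k - 2 = r.+1 & (k - 2).-1 = r]%N.
  by split; lia.
rewrite e3 e1 e2 /F er !natrD !natrM !chebWS chebW1 chebW0.
move: (chebW K r) (chebW K r.+1) => P Q.
by split; apply: poly_horner_inj => x; rewrite !horner_ringE; field.
Qed.

Lemma laguerre_freud_penultimate n j : j.+2 = k -> LF (n * k + j)%N.
Proof.
move=> jk; have j0 : (0 < j)%N by lia.
have ei : (n * k + j).+2 = (n.+1 * k)%N by rewrite -!addnS jk mulSn addnC.
rewrite /LF ei (sieved_gammaS_structM ei) structM_start structN_start -addnS.
rewrite sieved_gamma_generic ?structM_block ?structN_block; try lia.
have [e1 e2] : (k - j = 2 /\ k - j.+1 = 1)%N by lia.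
rewrite e1 e2 /= /F -jk !chebWS chebW1 chebW0.
move: (chebW K j) (chebW K j.+1) => P Q.
by split; apply: poly_horner_inj => x; rewrite !horner_ringE; field.
Qed.

(** Both recurrence coefficients of the second equation are exceptional here; in
    [M] they meet polynomials of two neighbouring blocks, whose terms in
    [U_(k-3)] are opposite. *)
Lemma laguerre_freud_last n j : j.+1 = k -> LF (n * k + j)%N.
Proof.
move=> jk; have j0 : (0 < j)%N by lia.
have [a ea] : exists a, j = a.+2 by exists j.-2; lia.
have ei : (n * k + j).+1 = (n.+1 * k)%N by rewrite -!addnS jk mulSn addnC.
rewrite /LF ei -(addn1 (_ * _)%N) sieved_gamma_dvd (sieved_gamma_dvdS ei).
rewrite structM_start structN_start !structM_block ?structN_block; try lia.
have [e1 e2] : (k - j = 1 /\ k - 1 = a.+2)%N by lia.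
rewrite e1 e2 /= /F -jk ea !chebWS chebW1 chebW0.
have := lamN (ltn0Sn n); rewrite -natr1 => n0.
move: (chebW K a) (chebW K a.+1) => P Q.
by split; apply: poly_horner_inj => x; rewrite !horner_ringE; field.
Qed.

(** The two equations see the positions [i], [i + 1], [i + 2]; one of them is a
    multiple of [k] when the residue of [i] is [0], [k - 2] or [k - 1]. *)
Lemma sieved_laguerre_freud i : LF i.
Proof.
rewrite (divn_eq i k); have := ltn_pmod i (ltn_trans (isT : 0 < 2)%N k3).
move: (i %/ k)%N (i %% k)%N => n [|j] jk.
  by rewrite addn0; apply: laguerre_freud_first.
have [jk2|jk2] := ltnP j.+3 k; first exact: laguerre_freud_inner.
have [|jk3] := eqVneq j.+3 k; first exact: laguerre_freud_penultimate.
by apply: laguerre_freud_last; lia.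
Qed.

Lemma sieved_structure_relation (p : nat -> {poly K}) :
  p 0%N = 1 -> p 1%N = 'X ->
  (forall i, p i.+2 = 'X * p i.+1 - g i.+1 *: p i) ->
  forall i, F * (p i)^`() = M i.+1 * p i.+1 + N i.+1 * p i.
Proof.
move=> p0 p1 prec; apply: (structure_of_laguerre_freud (g := g)) => //.
- by rewrite /g /sieved_gamma dvdn0 div0n mul0r.
- exact: laguerre_freud_init.
- by move=> i; case: (sieved_laguerre_freud i).
- by move=> i; case: (sieved_laguerre_freud i).
Qed.

Lemma Phi_chebW : Phi K k = F.
Proof. by rewrite /Phi Uhat_chebW. Qed.

Lemma Mpoly_structM n j : (j < k)%N -> Mpoly k lam n j = M (n * k + j).+1.
Proof.
move=> jk; rewrite /Mpoly addn1 !Uhat_chebW.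
have -> : j%:Z = j.+1%:Z - 1 by lia.
rewrite Uhat_chebW.
have [jk1|jk1] := eqVneq j.+1 k.
  have -> : (n * k + j).+1 = (n.+1 * k)%N by rewrite -addnS jk1 mulSn addnC.
  have -> : k%:Z - (j.+1%:Z - 1) - 2 = -1 by lia.
  have -> : k%:Z - (j.+1%:Z - 1) - 3 = -2 by lia.
  by rewrite /= !mulr0 subrr scaler0 subr0 structM_start.
have -> : k%:Z - (j.+1%:Z - 1) - 2 = (k - j.+1)%N%:Z - 1 by lia.
have -> : k%:Z - (j.+1%:Z - 1) - 3 = (k - j.+2)%N%:Z - 1 by lia.
rewrite !Uhat_chebW -!addnS structM_block; last by lia.
by rewrite (_ : (k - j.+2).+1 = k - j.+1)%N //; lia.
Qed.

Lemma Npoly_structN n j : (j < k)%N -> Npoly k lam n j = N (n * k + j).+1.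
Proof.
move=> jk; rewrite /Npoly addn2 !Uhat_chebW.
have -> : j%:Z = j.+1%:Z - 1 by lia.
have -> : k%:Z - 2 = k.-1%:Z - 1 by lia.
rewrite !Uhat_chebW prednK; last by lia.
have [jk1|jk1] := eqVneq j.+1 k.
  have -> : (n * k + j).+2 = (n.+1 * k).+1%N by rewrite -addnS jk1 mulSn addnC.
  have -> : (n * k + j).+1 = (n.+1 * k)%N by rewrite -addnS jk1 mulSn addnC.
  have -> : k%:Z - (j.+1%:Z - 1) - 3 = -2 by lia.
  have -> : k%:Z - (j.+1%:Z - 1) - 4 = -3 by lia.
  have -> : eps K k j = 1 by rewrite /eps ifT //; apply/eqP; lia.
  by rewrite /= !mulr0 subrr scaler0 addr0 mulr1 structN_start.
rewrite -!addnS structN_block; last by lia.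
have -> : k%:Z - (j.+1%:Z - 1) - 3 = (k - j.+2)%N%:Z - 1 by lia.
rewrite Uhat_chebW (_ : (k - j.+2).+1 = k - j.+1)%N; last by lia.
have [jk2|jk2] := eqVneq j.+2 k.
  have -> : k%:Z - (j.+1%:Z - 1) - 4 = -2 by lia.
  (* [Uhat] vanishes at index -2 where [chebW] is -4; the term lost is the
     change of [eps] from 1/2 to 0. *)
  have -> : eps K k j = 0.
    by rewrite /eps ifF ?ifT //; [apply/eqP | apply/negbTE/eqP]; lia.
  have -> : (k - j.+1 = 1)%N by lia.
  rewrite -[in chebW K k]jk2 chebW1 chebW0 /=; move: (chebW K j.+2) => P.
  by apply: poly_horner_inj => x; rewrite !horner_ringE; field.
have -> : k%:Z - (j.+1%:Z - 1) - 4 = (k - j.+3)%N%:Z - 1 by lia.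
have -> : eps K k j = 2%:R^-1.
  by rewrite /eps !ifF //; apply/negbTE/eqP; lia.
rewrite Uhat_chebW (_ : (k - j.+3).+1 = (k - j.+1).-1)%N; last by lia.
by rewrite -addnS opprB addrA [RHS]addrAC.
Qed.

End LaguerreFreud.

(** * Complex powers near 1 and roots of unity *)

Section ComplexPowers.
Local Open Scope classical_set_scope.
Variable R : realType.
Implicit Types (a b : Cplx R) (s t : R).

(** Limit rules with the functions written out pointwise, which is the form
    that the recurrence of [qultra] produces. *)
Section LimitsAtOne.
Implicit Types (f g : R -> Cplx R) (l m : Cplx R).

Lemma cvgC_near_eq f g l : (\forall s \near 1^'-, f s = g s) ->
  f s @[s --> 1^'-] --> l -> g s @[s --> 1^'-] --> l.
Proof. by move=> fg; exact: (cvg_trans (near_eq_cvg fg)). Qed.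

Lemma cvgC_sub f g l m : f s @[s --> 1^'-] --> l -> g s @[s --> 1^'-] --> m ->
  f s - g s @[s --> 1^'-] --> l - m.
Proof. exact: cvgB. Qed.

Lemma cvgC_mul f g l m : f s @[s --> 1^'-] --> l -> g s @[s --> 1^'-] --> m ->
  f s * g s @[s --> 1^'-] --> l * m.
Proof. exact: cvgM. Qed.

Lemma cvgC_div f g l m : m != 0 -> f s @[s --> 1^'-] --> l ->
  g s @[s --> 1^'-] --> m -> f s / g s @[s --> 1^'-] --> l / m.
Proof. by move=> m0 fl gm; exact: (cvgM fl (cvgV m0 gm)). Qed.

Lemma cvgC_cst l : (fun=> l) s @[s --> (1 : R)^'-] --> l.
Proof. exact: cvg_cst. Qed.

End LimitsAtOne.
Arguments cvgC_cst : clear implicits.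

Lemma ofRealB s t : ofReal (s - t) = ofReal s - ofReal t :> Cplx R.
Proof. exact: (rmorphB (real_complex R)). Qed.

Lemma ofRealV s : ofReal s^-1 = (ofReal s)^-1 :> Cplx R.
Proof. exact: (fmorphV (real_complex R)). Qed.

Lemma ofReal_eq0 s : (ofReal s == 0 :> Cplx R) = (s == 0).
Proof. exact: (fmorph_eq0 (real_complex R)). Qed.

Lemma norm_ofReal s : `|ofReal s| = ofReal `|s| :> Cplx R.
Proof. by rewrite [LHS]normc_def /= expr0n /= addr0 sqrtr_sqr. Qed.

Lemma cvg_ofReal (T : Type) (F : set_system T) {FF : Filter F} (f : T -> R) (l : R) :
  f @ F --> l -> (fun x => ofReal (f x) : Cplx R) @ F --> (ofReal l : Cplx R).
Proof.
move=> /cvgrPdist_le fl; apply/cvgrPdist_le => -[e e'] /=.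
rewrite ltcE /= => /andP[/eqP -> /fl]; apply: filterS => x flx.
by rewrite -ofRealB norm_ofReal lecE /= eqxx.
Qed.

Lemma ofReImE s t : ofReIm s t = ofReal s + 'i * ofReal t :> Cplx R.
Proof.
by apply/eqP; rewrite eq_complex /=; apply/andP; split; apply/eqP => /=; ring.
Qed.

Lemma cvg_ofReIm (T : Type) (F : set_system T) {FF : Filter F} (f g : T -> R) (l m : R) :
  f @ F --> l -> g @ F --> m ->
  (fun x => ofReIm (f x) (g x) : Cplx R) @ F --> (ofReIm l m : Cplx R).
Proof.
move=> fl gm; rewrite ofReImE.
under eq_fun do rewrite ofReImE.
by apply: cvgD; [|apply: cvgM; [exact: cvg_cst|]]; exact: cvg_ofReal.
Qed.

Lemma cpowD s a b : cpow s (a + b) = cpow s a * cpow s b.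
Proof.
case: a b => [a a'] [b b']; rewrite /cpow /ofReIm /=; simpc.
by rewrite !mulrDl expRD cosD sinD; congr (_ +i* _)%C; ring.
Qed.

Lemma cpow0 s : cpow s 0 = 1.
Proof. by rewrite /cpow /= !mul0r expR0 cos0 sin0 mulr1 mulr0. Qed.

Lemma cpow1 s : 0 < s -> cpow s 1 = ofReal s.
Proof.
by move=> s0; rewrite /cpow /= mul1r mul0r cos0 sin0 mulr1 mulr0 lnK.
Qed.

Lemma cpow_nat s n : 0 < s -> cpow s n%:R = ofReal s ^+ n.
Proof.
move=> s0; elim: n => [|n IHn]; first by rewrite cpow0.
by rewrite -natr1 cpowD IHn cpow1 // exprSr.
Qed.

Lemma slope_left (f : R -> R) (x d : R) : is_derive x 1 f d ->
  (f x - f s) / (x - s) @[s --> x^'-] --> d.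
Proof.
move=> [df <-].
have H : h^-1 *: (f (h *: 1 + x) - f x) @[h --> 0^'] --> 'D_1 f x.
  exact: df.
have sh : s - x @[s --> x^'-] --> (0 : R)^'.
  move=> A /nbhs_ballP[e /= e0 eA]; rewrite /nbhs /=; near=> s.
  have sx : s < x by near: s; exact: nbhs_left_lt.
  apply: (eA (s - x)); last by rewrite subr_eq0 lt_eqF.
  rewrite -ball_normE /ball_ /= sub0r opprB gtr0_norm ?subr_gt0 //.
  by near: s; exact: nbhs_left_ltBl.
apply: cvg_trans (cvg_comp _ _ sh H).
apply: near_eq_cvg; near=> s => /=.
rewrite -[_ *: 1]/(_ * 1) mulr1 subrK -[LHS]/(_ * _).
by rewrite -[x - s]opprB -[f x - f s]opprB invrN mulrNN mulrC.
Unshelve. all: by end_near. Qed.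

Lemma is_derive_cpow_re b : is_derive (1:R) 1
  (fun s => expR (complex.Re b * ln s) * cos (complex.Im b * ln s)) (complex.Re b).
Proof.
have dln := @is_derive1_ln R 1 ltr01; apply: trigger_derive.
rewrite /= ln1 !mulr0 expR0 cos0 sin0 !scale1r oppr0 mul0r add0r mul1r invr1.
exact: mulr1.
Qed.

Lemma is_derive_cpow_im b : is_derive (1:R) 1
  (fun s => expR (complex.Re b * ln s) * sin (complex.Im b * ln s)) (complex.Im b).
Proof.
have dln := @is_derive1_ln R 1 ltr01; apply: trigger_derive.
rewrite /= ln1 !mulr0 expR0 cos0 sin0 !scale1r scale0r addr0 mul1r invr1.
exact: mulr1.
Qed.

(** This is a derivative at [s = 1], computed componentwise: the real and the
    imaginary part of [s^b] are real functions of [s] with derivatives [Re b]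
    and [Im b] there. *)
Lemma cpow_slope b :
  (1 - cpow s b) / ofReal (1 - s) @[s --> (1:R)^'-] --> b.
Proof.
have {2}<- : ofReIm (complex.Re b) (complex.Im b) = b by case: b.
have H := cvg_ofReIm (slope_left (is_derive_cpow_re b))
                     (slope_left (is_derive_cpow_im b)).
apply: (cvgC_near_eq _ (H _)); near=> s.
rewrite /= -ofRealV ln1 !mulr0 expR0 cos0 sin0 mulr1 mulr0.
rewrite /cpow /ofReIm /ofReal; simpc; congr (_ +i* _)%C; ring.
Unshelve. all: by end_near. Qed.

Arguments cpow_slope : clear implicits.

Lemma cvg_cpow1 b : cpow s b @[s --> (1:R)^'-] --> (1 : Cplx R).
Proof.
have h : ofReal (1 - s) @[s --> (1:R)^'-] --> (0 : Cplx R).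
  rewrite -(_ : ofReal (1 - 1) = 0); last by rewrite subrr.
  apply: cvg_ofReal; apply: cvgB; first exact: cvg_cst.
  exact: cvg_at_left_filter.
have H := cvgC_sub (cvgC_cst (1 : Cplx R)) (cvgC_mul (cpow_slope b) h).
rewrite mulr0 subr0 in H.
apply: (cvgC_near_eq _ H); near=> s.
rewrite divfK ?opprB ?subrKC // ofReal_eq0 subr_eq0 gt_eqF //.
Unshelve. all: by end_near. Qed.

Arguments cvg_cpow1 : clear implicits.

(** For [z <> 1] numerator and denominator tend to [1 - z]; for [z = 1] both
    vanish at [s = 1] and the limit is the quotient of their derivatives. *)
Lemma cvg_cpow_quot b m (z : Cplx R) : (0 < m)%N ->
  (1 - cpow s b * z) / (1 - cpow s m%:R * z) @[s --> (1:R)^'-] -->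
    (if z == 1 then b / m%:R else 1).
Proof.
move=> m0; have mn0 : m%:R != 0 :> Cplx R by rewrite pnatr_eq0 -lt0n.
case: eqVneq => [-> | z1].
  apply: (cvgC_near_eq _ (cvgC_div mn0 (cpow_slope b) (cpow_slope m%:R))).
  near=> s; rewrite !mulr1 invf_div mulrA divfK //.
  rewrite ofReal_eq0 subr_eq0 gt_eqF //.
have one_sub c : 1 - cpow s c * z @[s --> (1:R)^'-] --> 1 - z.
  have := cvgC_sub (cvgC_cst (1 : Cplx R)) (cvgC_mul (cvg_cpow1 c) (cvgC_cst z)).
  by rewrite mul1r.
have z1' : 1 - z != 0 by rewrite subr_eq0 eq_sym.
by have := cvgC_div z1' (one_sub b) (one_sub m%:R); rewrite divff.
Unshelve. all: by end_near. Qed.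

Lemma omega_exp k m : omega R k ^+ m =
  ofReIm (cos (2 * pi / k%:R * m%:R)) (sin (2 * pi / k%:R * m%:R)).
Proof.
elim: m => [|m IHm]; first by rewrite expr0 mulr0 cos0 sin0.
have -> : 2 * pi / k%:R * m.+1%:R = 2 * pi / k%:R * m%:R + 2 * pi / k%:R :> R.
  by rewrite -[m.+1%:R]natr1; ring.
rewrite exprSr IHm /omega /ofReIm cosD sinD; simpc.
by congr (_ +i* _)%C; ring.
Qed.

Lemma omega_exp_eq1 k m : (0 < k)%N -> (omega R k ^+ m == 1) = (k %| m)%N.
Proof.
move=> k0; have kn0 : k%:R != 0 :> R by rewrite pnatr_eq0 -lt0n.
have wk : omega R k ^+ k = 1.
  by rewrite omega_exp divfK // mulr_natl cos2pi sin2pi.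
apply/eqP/idP => [|/dvdnP[c ->]]; last by rewrite mulnC exprM wk expr1n.
rewrite [in X in X -> _](divn_eq m k) exprD mulnC exprM wk expr1n mul1r.
rewrite omega_exp => -[c1 _]; rewrite /dvdn; apply: contraT; rewrite -lt0n => r0.
have rk : (m %% k < k)%N by rewrite ltn_pmod.
(* With [2 t] the argument of [omega ^ m], [cos (2 t) = 1] says [sin t = 0],
   whereas [0 < t < pi] unless [k] divides [m]. *)
pose t : R := pi / k%:R * (m %% k)%:R.
have : 0 < sin t.
  rewrite sin_gt0_pi // /t -mulrA; apply/andP; split.
    by rewrite mulr_gt0 ?pi_gt0 // mulr_gt0 ?invr_gt0 ?ltr0n.
  by rewrite gtr_pMr ?pi_gt0 // mulrC ltr_pdivrMr ?ltr0n // mul1r ltr_nat.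
have : cos (t *+ 2) = 1.
  by rewrite -c1; congr cos; rewrite /t -mulr_natl; ring.
rewrite mulr2n cosD => ct st0.
have := cos2Dsin2 t; nra.
Qed.

End ComplexPowers.
Arguments cvgC_cst {R} l.

(** * The sieved polynomials as a limit *)

(** Limits of the quotients of coefficients in the recurrence of [qultra]: with
    [a = lam] for [(1 - b q^n) / (1 - q^(n+1))] and [a = 2 lam] for
    [(1 - b^2 q^(n-1)) / (1 - q^(n+1))], where [i = n + 1]. *)
Definition sieved_ratio (K : fieldType) (k : nat) (a : K) (i : nat) : K :=
  if (k %| i)%N then (a * k%:R + i%:R) / i%:R else 1.

Fixpoint sieved_limit (K : fieldType) (k : nat) (lam : K) (n : nat) : {poly K} :=
  match n with
  | 0 => 1
  | n'.+1 => match n' with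
    | 0 => (2%:R * sieved_ratio k lam n) *: 'X
    | m.+1 => (2%:R * sieved_ratio k lam n) *: ('X * sieved_limit k lam n')
              - sieved_ratio k (2%:R * lam) n *: sieved_limit k lam m
    end
  end.

Section Limit.
Local Open Scope classical_set_scope.
Variables (R : realType) (k : nat) (lam : Cplx R).
Hypothesis k0 : (0 < k)%N.

Let b s : Cplx R := cpow s (lam * k%:R + 1) * omega R k.
Let q s : Cplx R := ofReal s * omega R k.

Lemma cvg_sieved_quot (a : Cplx R) i : (0 < i)%N ->
  (1 - cpow s (a * k%:R + i%:R) * omega R k ^+ i) /
  (1 - cpow s i%:R * omega R k ^+ i) @[s --> (1 : R)^'-] --> sieved_ratio k a i.
Proof.
move=> i0; have H := @cvg_cpow_quot R (a * k%:R + i%:R) i (omega R k ^+ i) i0.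
by rewrite omega_exp_eq1 in H.
Qed.

Arguments cvg_sieved_quot : clear implicits.

Lemma qexpE s n : 0 < s -> q s ^+ n = cpow s n%:R * omega R k ^+ n.
Proof. by move=> s0; rewrite exprMn cpow_nat. Qed.

Lemma bqexpE s n : 0 < s ->
  b s * q s ^+ n = cpow s (lam * k%:R + n.+1%:R) * omega R k ^+ n.+1.
Proof.
move=> s0; rewrite qexpE // /b exprS.
have -> : lam * k%:R + n.+1%:R = (lam * k%:R + 1) + n%:R :> Cplx R.
  by rewrite -[n.+1%:R]natr1; ring.
rewrite [cpow s (_ + n%:R)]cpowD; ring.
Qed.

Lemma b2qexpE s n : 0 < s ->
  b s ^+ 2 * q s ^+ n =
  cpow s (2%:R * lam * k%:R + n.+2%:R) * omega R k ^+ n.+2.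
Proof.
move=> s0; rewrite qexpE // /b !exprS expr0 mulr1.
have -> : 2%:R * lam * k%:R + n.+2%:R =
    (lam * k%:R + 1) + (lam * k%:R + 1) + n%:R :> Cplx R.
  by rewrite -[n.+2]addn2 natrD; ring.
rewrite [cpow s (_ + n%:R)]cpowD [cpow s (_ + (_ + 1))]cpowD; ring.
Qed.

Lemma cvg_qultra n x :
  (qultra (b s) (q s) n).[x] @[s --> (1 : R)^'-] --> (sieved_limit k lam n).[x].
Proof.
suff: (qultra (b s) (q s) n).[x] @[s --> (1 : R)^'-]
          --> (sieved_limit k lam n).[x] /\
      (qultra (b s) (q s) n.+1).[x] @[s --> (1 : R)^'-]
          --> (sieved_limit k lam n.+1).[x] by case.
elim: n => [|n [IH1 IH2]]; split; [| |exact: IH2|].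
- exact: cvgC_cst.
- rewrite /= hornerZ hornerX.
  have H := cvgC_mul (cvgC_mul (cvgC_cst 2%:R)
       (cvg_sieved_quot lam 1 (ltn0Sn 0))) (cvgC_cst x).
  apply: (cvgC_near_eq _ H); near=> s.
  have s0 : 0 < s by near: s; exact: nbhs_left_gt.
  rewrite hornerZ hornerX -(bqexpE 0) // -(qexpE 1) // expr0 expr1; ring.
- rewrite [sieved_limit _ _ n.+2]/= -/(sieved_limit k lam n.+1).
  rewrite hornerD hornerN !hornerZ hornerM hornerX.
  have H := cvgC_sub (cvgC_mul (cvgC_mul (cvgC_cst 2%:R)
       (cvg_sieved_quot lam n.+2 (ltn0Sn n.+1))) (cvgC_mul (cvgC_cst x) IH2))
     (cvgC_mul (cvg_sieved_quot (2%:R * lam) n.+2 (ltn0Sn n.+1)) IH1).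
  apply: (cvgC_near_eq _ H); near=> s.
  have s0 : 0 < s by near: s; exact: nbhs_left_gt.
  rewrite -bqexpE // -b2qexpE // -qexpE //.
  rewrite [qultra _ _ n.+2]/= -/(qultra (b s) (q s) n.+1).
  rewrite hornerZ hornerD hornerN hornerM !hornerZ hornerX; ring.
Unshelve. all: by end_near. Qed.

Lemma sievedB_limit n x : sievedB k lam n x = (sieved_limit k lam n).[x].
Proof. by apply: cvg_lim; [exact: norm_hausdorff | exact: cvg_qultra]. Qed.

End Limit.

Section MonicRecurrence.
Variables (K : numFieldType) (k : nat) (lam : K).
Hypothesis k3 : (3 <= k)%N.
Hypothesis lamN : forall m, (0 < m)%N -> m%:R + lam != 0.

Lemma pochhammerS (a : K) n : pochhammer a n.+1 = pochhammer a n * (a + n%:R).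
Proof. by rewrite /pochhammer big_ord_recr. Qed.

Lemma pochhammer_neq0 n : pochhammer (lam + 1) n != 0.
Proof.
by apply/prodf_neq0 => i _; rewrite -addrA addrC nat1r lamN.
Qed.

Lemma sieved_monic0 : nu k lam 0 *: sieved_limit k lam 0 = 1.
Proof. by rewrite /nu div0n /pochhammer big_ord0 expr0 mul1r divr1 scale1r. Qed.

Lemma sieved_monic1 : nu k lam 1 *: sieved_limit k lam 1 = 'X.
Proof.
rewrite /= scalerA /nu /sieved_ratio divn_small ?gtnNdvd //; try lia.
by rewrite /pochhammer big_ord0 expr1 fact0 !mulr1 mul1r mulVf ?scale1r ?pnatr_eq0.
Qed.

(** The factor [nu] is what makes the limit polynomials monic; the second
    equation is where the coefficients [sieved_gamma] come from. *)
Lemma nu_ratio i :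
  nu k lam i.+2 * (2%:R * sieved_ratio k lam i.+2) = nu k lam i.+1 /\
  nu k lam i.+2 * sieved_ratio k (2%:R * lam) i.+2 =
    sieved_gamma k lam i.+1 * nu k lam i.
Proof.
rewrite /nu /sieved_ratio /sieved_gamma.
have t0 : 2%:R ^+ i != 0 :> K by rewrite expf_neq0 // pnatr_eq0.
have kn0 : k%:R != 0 :> K by rewrite pnatr_eq0; lia.
have [n [j [jk ei]]] : exists n j, (j < k)%N /\ i.+1 = (n * k + j)%N.
  exists (i.+1 %/ k)%N, (i.+1 %% k)%N; split; last exact: divn_eq.
  by rewrite ltn_pmod //; lia.
have divE e c l : e = (c * k + l)%N -> (l < k)%N ->
    (e %/ k = c)%N /\ (k %| e)%N = (l == 0)%N.
  move=> -> lk; rewrite divnMDl ?divn_small ?addn0; try lia.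
  by rewrite dvdn_addr ?dvdn_mull // /dvdn modn_small.
have [e1 v1] := divE _ _ _ ei jk.
have pn := pochhammer_neq0 n.
have [jk1|jk1] := eqVneq j.+1 k.
  have [e2 v2] : (i.+2 %/ k = n.+1)%N /\ (k %| i.+2)%N = (0 == 0)%N.
    by apply: divE; lia.
  have [e0 _] : (i %/ k = n)%N /\ (k %| i)%N = (j.-1 == 0)%N by apply: divE; lia.
  have ei2 : i.+2%:R = n.+1%:R * k%:R :> K by rewrite -natrM; congr (_%:R); lia.
  have ln := lamN (ltn0Sn n).
  rewrite e0 e1 e2 v1 v2 eqxx ifF; last by lia.
  rewrite ei2 pochhammerS factS natrM !exprS.
  have n0 : n.+1%:R != 0 :> K by rewrite pnatr_eq0.
  have -> : lam + 1 + n%:R = n.+1%:R + lam :> K by rewrite -natr1; ring.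
  have f0 : n`!%:R != 0 :> K by rewrite pnatr_eq0 -lt0n fact_gt0.
  move: (n.+1%:R) (n`!%:R) (pochhammer _ _) (2%:R ^+ i) => nn f P t in n0 ln f0 pn t0 *.
  by split; field; rewrite ?n0 ?ln ?f0 ?pn ?t0 ?kn0.
have [e2 v2] : (i.+2 %/ k = n)%N /\ (k %| i.+2)%N = (j.+1 == 0)%N.
  by apply: divE; lia.
have f0 m : m`!%:R != 0 :> K by rewrite pnatr_eq0 -lt0n fact_gt0.
rewrite e1 e2 v1 v2 !exprS /=; case: eqP => [j0 | /eqP j0].
  case: n => [|n] in ei e1 e2 pn *; first by lia.
  have [e0 _] : (i %/ k = n)%N /\ (k %| i)%N = (k.-1 == 0)%N by apply: divE; lia.
  have ln := lamN (ltn0Sn n); have pn' := pochhammer_neq0 n.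
  have n0 : n.+1%:R != 0 :> K by rewrite pnatr_eq0.
  rewrite e0 pochhammerS factS natrM.
  have -> : lam + 1 + n%:R = n.+1%:R + lam :> K by rewrite -natr1; ring.
  have := f0 n; move: (n.+1%:R) (n`!%:R) (pochhammer _ _) (2%:R ^+ i)
     => nn f P t in n0 ln pn' t0 * => f0'.
  by split; field; rewrite ?n0 ?ln ?f0' ?pn' ?t0.
have [e0 _] : (i %/ k = n)%N /\ (k %| i)%N = (j.-1 == 0)%N by apply: divE; lia.
by rewrite e0; split; field; rewrite ?f0 ?pn ?t0.
Qed.

Lemma sieved_monic_rec i (p := fun n => nu k lam n *: sieved_limit k lam n) :
  p i.+2 = 'X * p i.+1 - sieved_gamma k lam i.+1 *: p i.
Proof.
rewrite /p [sieved_limit _ _ i.+2]/= -/(sieved_limit k lam i.+1).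
by have [e1 e2] := nu_ratio i; rewrite scalerBr !scalerA e1 e2 scalerAr.
Qed.

End MonicRecurrence.

(** * The structure relation *)

Theorem theorem4p2 (R : realType) (k : nat) (lam : Cplx R)
    (p : nat -> {poly Cplx R})
    (hk : (3 <= k)%N)
    (hlam : forall n : nat, (1 <= n)%N -> lam <> - (n%:R / 2%:R))
    (hp : forall (n : nat) (x : Cplx R),
        (p n).[x] = nu k lam n * sievedB k lam n x) :
  forall n j : nat, (j <= k - 1)%N ->
    Phi (Cplx R) k * (p (n * k + j)%N)^`() =
      Mpoly k lam n j * p (n * k + j + 1)%N + Npoly k lam n j * p (n * k + j)%N.
Proof.
have k0 : (0 < k)%N by lia.
have lamN m : (0 < m)%N -> m%:R + lam != 0.
  move=> m0; apply/eqP => /eqP; rewrite addrC addr_eq0 => /eqP lm.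
  apply: (hlam (m * 2)%N); first by rewrite muln_gt0 m0.
  by rewrite natrM mulfK ?pnatr_eq0.
have pE n : p n = nu k lam n *: sieved_limit k lam n.
  by apply: poly_horner_inj => x; rewrite hp sievedB_limit // hornerZ.
move=> n j jk; have {}jk : (j < k)%N by lia.
rewrite Phi_chebW Mpoly_structM // Npoly_structN // addn1.
apply: sieved_structure_relation => // [||i]; rewrite !pE.
- exact: sieved_monic0.
- exact: sieved_monic1.
- exact: sieved_monic_rec.
Qed.
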